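(* Let $C$ be a (nonempty) completely pseudo-regular code in a finite simple connected graph $\Gamma$, with dual degree $d_C$ and subconstituents $C_k$, $k=0,1,\ldots,\varepsilon_C(=d_C)$. Then, for each such $k$, the dual degree of the $k$-th subconstituent satisfies $$d_{C_k}\ge\max\{k,\,d_C-k\}.$$ Consequently, the $C$-local predistance polynomial $p_k$ vanishes at at most $\min\{k,\,d_C-k\}$ different eigenvalues of $\mathrm{ev}_C\Gamma$.
   Context: $\Gamma=(V,E)$ is a finite simple connected graph with vertex set $V=\{1,\ldots,n\}$, adjacency matrix $\boldsymbol{A}$ and distance function $\partial$; $\Gamma(i)$ is the set of neighbours of vertex $i$. The distinct eigenvalues of $\boldsymbol{A}$ are $\lambda_0>\lambda_1>\cdots>\lambda_d$, with eigenspaces $\mathcal{E}_l=\ker(\boldsymbol{A}-\lambda_l\boldsymbol{I})$, and $\boldsymbol{E}_l$ is the orthogonal projection of $\mathbb{R}^n$ onto $\mathcal{E}_l$. The vector $\boldsymbol{\nu}=(\nu_1,\ldots,\nu_n)\in\mathcal{E}_0$ is the unique positive eigenvector with minimum component equal to $1$. The vectors $\boldsymbol{e}_i$ are the coordinate vectors of $\mathbb{R}^n$. For nonempty $S\subset V$, $\boldsymbol{\rho}S:=\sum_{i\in S}\nu_i\boldsymbol{e}_i$ and $\boldsymbol{e}_S:=\boldsymbol{\rho}S/\|\boldsymbol{\rho}S\|$. The $S$-multiplicity of $\lambda_l$ is $m_S(\lambda_l):=\|\boldsymbol{E}_l\boldsymbol{e}_S\|^2$, and $\mathrm{ev}_S\Gamma$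 is the set of eigenvalues of $\boldsymbol{A}$ with nonzero $S$-multiplicity. The dual degree of $S$ is $d_S:=|\mathrm{ev}_S\Gamma|-1$. Write $\mathrm{ev}_C\Gamma=\{\mu_0>\mu_1>\cdots>\mu_{d_C}\}$; one has $\mu_0=\lambda_0$. The $C$-local scalar product of polynomials is $\langle p,q\rangle_C:=\sum_{l=0}^{d_C}m_C(\mu_l)p(\mu_l)q(\mu_l)$. The $C$-local predistance polynomials $(p_k)_{0\le k\le d_C}$ are the unique polynomials with $\deg p_k=k$ and $\langle p_k,p_h\rangle_C=\delta_{kh}\,p_k(\mu_0)$ for $0\le k,h\le d_C$. For a vertex $i$, $\partial(i,C)=\min_{j\in C}\partial(i,j)$; the eccentricity of $C$ is $\varepsilon_C=\max_{i\in V}\partial(i,C)$; the subconstituents associated to $C$ are the sets $C_k=\{i\in V:\partial(i,C)=k\}$, $0\le k\le\varepsilon_C$. For $i\in C_k$ put $c(i)=\frac1{\nu_i}\sum_{j\in\Gamma(i)\cap C_{k-1}}\nu_j$ (and $c(i)=0$ if $k=0$), $a(i)=\frac1{\nu_i}\sum_{j\in\Gamma(i)\cap C_k}\nu_j$, $b(i)=\frac1{\nu_i}\sum_{j\in\Gamma(i)\cap C_{k+1}}\nu_j$ (and $b(i)=0$ if $k=\varepsilon_C$). The set $C$ is a completely pseudo-regular code if, for every $k$, the values $c(i),a(i),b(i)$ are the same for all $i\in C_k$. It is a known fact that a completely pseudo-regular code satisfies $\varepsilon_C=d_C$. *)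

(* Defs.v *)
From HB Require Import structures.
From mathcomp Require Import all_boot all_order all_algebra.
From mathcomp Require Import polyrcf.
From mathcomp Require Import reals.

Set Implicit Arguments.
Unset Strict Implicit.
Unset Printing Implicit Defensive.

Import Order.TTheory GRing.Theory Num.Theory.
Local Open Scope ring_scope.

(* Vectors of R^n are row vectors and matrices act on the right; the matrices
   involved are symmetric, so this is the usual column-vector setting. *)

Section Distance.
Variables (n : nat) (e : rel 'I_n).

(* Length of a shortest walk from i to j; it is the junk value n when there is
   none, and a true distance is always < n. *)
Definition gdist (i j : 'I_n) : nat :=
  find (fun k => [exists w : k.-tuple 'I_n, path e i w && (last i w == j)])
       (iota 0 n).

(* The minimum for nonempty C, since every distance is at most n. *)
Definition gdist_set (C : {set 'I_n}) (i : 'I_n) : nat :=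
  \big[minn/n]_(j in C) gdist i j.

Definition eccentricity (C : {set 'I_n}) : nat := \max_(i < n) gdist_set C i.

Definition subconstituent (C : {set 'I_n}) (k : nat) : {set 'I_n} :=
  [set i | gdist_set C i == k].

End Distance.

Section Spectrum.
Variable R : rcfType.

Definition adjacency n (e : rel 'I_n) : 'M[R]_n := \matrix_(i, j) (e i j)%:R.

(* The distinct eigenvalues in decreasing order (rootsR is increasing). *)
Definition eigenvals n (A : 'M[R]_n) : seq R := rev (rootsR (char_poly A)).

Lemma mem_eigenvals n (A : 'M[R]_n) (a : R) :
  (a \in eigenvals A) = eigenvalue A a.
Proof.
have nz : char_poly A != 0 by rewrite monic_neq0 // char_poly_monic.
by rewrite mem_rev -(roots_on_rootsR nz) eigenvalue_root_char in_itv.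
Qed.

Lemma eigenvals_sorted n (A : 'M[R]_n) : sorted >%R (eigenvals A).
Proof. by rewrite rev_sorted; exact: sorted_roots. Qed.

Definition dotv n (u v : 'rV[R]_n) : R := (u *m v^T) 0 0.
Definition normv n (u : 'rV[R]_n) : R := Num.sqrt (dotv u u).

(* kermx U^T is the orthogonal complement of the row space of U. *)
Definition orthproj n (U : 'M[R]_n) : 'M[R]_n := proj_mx U (kermx U^T).

Definition eigenproj n (A : 'M[R]_n) (l : R) : 'M[R]_n :=
  orthproj (eigenspace A l).

Definition is_perron_vector n (A : 'M[R]_n) (nu : 'rV[R]_n) : Prop :=
  [/\ (nu <= eigenspace A (head 0 (eigenvals A)))%MS,
      forall i, 0 < nu 0 i,
      forall i, 1 <= nu 0 i
    & exists i, nu 0 i = 1].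

End Spectrum.

Section LocalSpectrum.
Variables (R : rcfType) (n : nat) (A : 'M[R]_n) (nu : 'rV[R]_n).
Implicit Type S : {set 'I_n}.

Definition rho S : 'rV[R]_n := \sum_(i in S) nu 0 i *: delta_mx 0 i.

Definition unit_rho S : 'rV[R]_n := (normv (rho S))^-1 *: rho S.

Definition local_mult S (l : R) : R :=
  normv (unit_rho S *m eigenproj A l) ^+ 2.

(* Strictly decreasing, as a filter of eigenvals A. *)
Definition local_ev S : seq R := [seq l <- eigenvals A | local_mult S l != 0].

(* local_ev S is nonempty whenever S is, so .-1 is then a true subtraction. *)
Definition dual_degree S : nat := (size (local_ev S)).-1.

Definition local_scalar S (p q : {poly R}) : R :=
  \sum_(mu <- local_ev S) local_mult S mu * p.[mu] * q.[mu].

Definition is_predistance_family S (p : nat -> {poly R}) : Prop :=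
  (forall k, (k <= dual_degree S)%N -> size (p k) = k.+1) /\
  (forall k h, (k <= dual_degree S)%N -> (h <= dual_degree S)%N ->
     local_scalar S (p k) (p h)
       = (k == h)%:R * (p k).[head 0 (local_ev S)]).

End LocalSpectrum.

Section PseudoRegularity.
Variables (R : rcfType) (n : nat) (e : rel 'I_n) (nu : 'rV[R]_n).
Variable C : {set 'I_n}.

Definition nbr_weight (i : 'I_n) (k : nat) : R :=
  (nu 0 i)^-1 * \sum_(j | e i j && (j \in subconstituent e C k)) nu 0 j.

Definition code_c (i : 'I_n) : R :=
  if gdist_set e C i is k.+1 then nbr_weight i k else 0.
Definition code_a (i : 'I_n) : R := nbr_weight i (gdist_set e C i).
Definition code_b (i : 'I_n) : R :=
  if gdist_set e C i == eccentricity e C then 0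
  else nbr_weight i (gdist_set e C i).+1.

Definition completely_pseudo_regular : Prop :=
  forall k, (k <= eccentricity e C)%N ->
  forall i j, i \in subconstituent e C k -> j \in subconstituent e C k ->
  [/\ code_c i = code_c j, code_a i = code_a j & code_b i = code_b j].

End PseudoRegularity.

(* Main.v *)
Require Import Defs.
From HB Require Import structures.
From mathcomp Require Import all_boot all_order all_algebra.
From mathcomp Require Import polyrcf.
From mathcomp Require Import reals.
From mathcomp Require Import complex spectral zify ring.

Set Implicit Arguments.
Unset Strict Implicit.
Unset Printing Implicit Defensive.

Import Order.TTheory GRing.Theory Num.Theory.
Local Open Scope ring_scope.

(** The adjacency matrix [A] is real symmetric, so the projections [eigenproj A l]
    split every vector orthogonally into eigenvectors.  Applied to the weighted
    characteristic vector [rho nu S], this turns [p(A)] into multiplication by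
    [p(l)] on each component: [p(A)] kills [rho nu S] exactly when [p] vanishes on
    [local_ev A nu S] ([rho_horner_eq0]), and [local_scalar] is, up to a positive
    factor, the scalar product of the vectors [p(A) (rho nu S)]
    ([local_scalarE]).

    If the walks of length [s] are the shortest ones joining [S] to
    some vertex [i], then a polynomial of degree [s] cannot kill [rho nu S], since
    the coordinate at [i] only sees its leading term; hence [S] has more than [s]
    local eigenvalues ([size_local_ev_gt]).  Let [C_k] be the layer of vertices at
    distance [k] from [C].  Going down to [C] gives a vertex at distance [k] from
    [C_k], and going up to the last layer gives one at distance [ecc - k], so the
    dual degree of [C_k] is at least [maxn k (ecc - k)].

    For a completely pseudo-regular
    code the vectors [rho nu C_k] obey a three-term recurrence under [A]
    ([rho_recurrence]), so [rho nu C_k = q_k(A) (rho nu C)] with [q_k] of degree [k]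
    ([rho_subconstituent_horner]).  The empty layer after the last one yields
    a polynomial of degree [ecc + 1] that kills [rho nu C], hence
    [dual_degree A nu C = ecc].

    The layers have disjoint supports, so the [q_k] are orthogonal
    for [local_scalar] and agree with the predistance polynomials up to a nonzero
    factor on the local eigenvalues of [C] ([predistance_proportional]).  Since
    [rho nu C_k = q_k(A) (rho nu C)], the local eigenvalues of [C_k] are those of [C]
    that are not roots of [p_k]; counting them against the lower bound above
    bounds the number of roots. *)

(** * Spectral decomposition of a real symmetric matrix *)

Section ScalarProduct.
Variables (R : rcfType) (n : nat).
Implicit Types (u v w : 'rV[R]_n) (A : 'M[R]_n).

Lemma dotvE u v : dotv u v = \sum_i u 0 i * v 0 i.
Proof. by rewrite /dotv mxE; apply: eq_bigr => i _; rewrite mxE. Qed.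

Lemma dotvC u v : dotv u v = dotv v u.
Proof. by rewrite !dotvE; apply: eq_bigr => i _; rewrite mulrC. Qed.

Lemma dotvZl a u v : dotv (a *: u) v = a * dotv u v.
Proof. by rewrite /dotv -scalemxAl mxE. Qed.

Lemma dotvZr a u v : dotv u (a *: v) = a * dotv u v.
Proof. by rewrite dotvC dotvZl dotvC. Qed.

Lemma dotv_suml (I : Type) (r : seq I) (F : I -> 'rV[R]_n) v :
  dotv (\sum_(i <- r) F i) v = \sum_(i <- r) dotv (F i) v.
Proof. by rewrite /dotv mulmx_suml summxE. Qed.

Lemma dotv_ge0 u : 0 <= dotv u u.
Proof. by rewrite dotvE sumr_ge0 // => i _; rewrite -expr2 sqr_ge0. Qed.

Lemma dotv_eq0 u : (dotv u u == 0) = (u == 0).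
Proof.
apply/eqP/eqP => [|->]; last by rewrite /dotv mul0mx mxE.
rewrite dotvE => /eqP; rewrite psumr_eq0 => [/allP u0|i _]; last first.
  by rewrite -expr2 sqr_ge0.
apply/rowP => i; rewrite mxE.
by have := u0 i (mem_index_enum i); rewrite /= mulf_eq0 orbb => /eqP.
Qed.

Lemma normv_sqr u : normv u ^+ 2 = dotv u u.
Proof. by rewrite sqr_sqrtr ?dotv_ge0. Qed.

Lemma dotv_mul_sym A u v : A^T = A -> dotv (u *m A) v = dotv u (v *m A).
Proof. by move=> symA; rewrite /dotv trmx_mul symA mulmxA. Qed.

End ScalarProduct.

Section SpectralDecomposition.
Variables (R : rcfType) (n : nat) (A : 'M[R]_n).
Hypothesis A_sym : A^T = A.

(** This form of diagonalizability, a subspace containing all eigenspaces is the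
    whole space, descends from [R[i]] to [R] by rank: over [R[i]] the matrix is
    hermitian, hence has an eigenbasis with real eigenvalues, and each of these
    eigenspaces is the extension of scalars of one over [R]. *)
Lemma eigenspaces_span (K : 'M[R]_n) :
  (forall l, (eigenspace A l <= K)%MS) -> (1%:M <= K)%MS.
Proof.
move=> sAK; pose f := real_complex R.
have fA_herm : map_mx f A \is hermsymmx.
  apply: realsym_hermsym.
    by apply/is_hermitianmxP; rewrite expr0 scale1r map_mx_id // map_trmx A_sym.
  by apply/mxOverP => i j; rewrite mxE; apply/complex_realP; exists (A i j).
have D_real := hermitian_spectral_diag_real fA_herm.
have := hermitian_normalmx fA_herm => /orthomx_spectralP.
set P := spectralmx _; set D := spectral_diag _ => fA_eq.
have PU : P \in unitmx by exact: spectral_unit.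
suff sPK : (P <= map_mx f K)%MS.
  rewrite -(map_submx f) map_mx1 (submx_trans _ sPK) // sub1mx.
  by rewrite row_full_unit.
apply/row_subP => i.
have /complex_realP[r Dr] : D 0 i \is Num.real by apply: (mxOverP D_real).
apply: (@submx_trans _ _ _ _ _ _ (map_mx f (eigenspace A r))); last first.
  by rewrite map_submx.
rewrite map_eigenspace; apply/eigenspaceP.
rewrite {1}fA_eq !mulmxA -row_mul mulmxV // row1 -rowE.
by rewrite row_diag_mx -scalemxAl -rowE Dr.
Qed.

Lemma eigenvector_dotv0 (l m : R) (v w : 'rV_n) : l != m ->
  (v <= eigenspace A l)%MS -> (w <= eigenspace A m)%MS -> dotv v w = 0.
Proof.
move=> neq_lm /eigenspaceP vA /eigenspaceP wA; apply/eqP.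
have := dotv_mul_sym v w A_sym; rewrite vA wA dotvZl dotvZr => /eqP.
by rewrite -subr_eq0 -mulrBl mulf_eq0 subr_eq0 (negPf neq_lm).
Qed.

(** Over an ordered field [w *m U *m U^T *m w^T] is a sum of squares, so it
    vanishes only with [w *m U]. *)
Lemma cap_orthogonal (U : 'M[R]_n) : (U :&: kermx U^T = 0)%MS.
Proof.
apply/eqP/rowV0P => v; rewrite sub_capmx => /andP[/submxP[w ->]] /sub_kermxP.
move=> /(congr1 (mulmx^~ w^T)); rewrite mul0mx -mulmxA -trmx_mul => wU.
by apply/eqP; rewrite -dotv_eq0 /dotv wU mxE.
Qed.

Lemma eigenproj_id (l : R) m (W : 'M_(m, n)) :
  (W <= eigenspace A l)%MS -> W *m eigenproj A l = W.
Proof. exact/proj_mx_id/cap_orthogonal. Qed.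

Lemma eigenproj_sub (l : R) m (W : 'M_(m, n)) :
  (W *m eigenproj A l <= eigenspace A l)%MS.
Proof. exact: proj_mx_sub. Qed.

Lemma eigenproj_0 (l m : R) p (W : 'M_(p, n)) :
  l != m -> (W <= eigenspace A m)%MS -> W *m eigenproj A l = 0.
Proof.
move=> neq_lm sWm; apply: proj_mx_0; first exact: cap_orthogonal.
apply/sub_kermxP/matrixP => i j; rewrite [RHS]mxE mxE.
have := @eigenvector_dotv0 m l (row i W) (row j (eigenspace A l)).
rewrite eq_sym => /(_ neq_lm (submx_trans (row_sub _ _) sWm) (row_sub _ _)).
rewrite dotvE => W_l0; rewrite -[RHS]W_l0; apply: eq_bigr => k _.
by rewrite 2![row _ _ _ _]mxE [_^T _ _]mxE.
Qed.

Lemma eigenspace_notin (l : R) : l \notin eigenvals A -> eigenspace A l = 0.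
Proof. by rewrite mem_eigenvals negbK => /eqP. Qed.

Lemma uniq_eigenvals : uniq (eigenvals A).
Proof. by rewrite rev_uniq uniq_roots. Qed.

(** The sum fixes every eigenspace, and these span; scalars that are not
    eigenvalues have a zero eigenspace. *)
Lemma sum_eigenproj : \sum_(l <- eigenvals A) eigenproj A l = 1%:M.
Proof.
set M := (X in X = _); apply/subr0_eq.
suff /sub_kermxP : (1%:M <= kermx (M - 1%:M))%MS by rewrite mul1mx.
apply: eigenspaces_span => m; apply/sub_kermxP.
rewrite mulmxBr mulmx1 mulmx_sumr; apply/eqP; rewrite subr_eq0; apply/eqP.
have [m_ev|/eigenspace_notin ->] := boolP (m \in eigenvals A); last first.
  by rewrite big1 // => l _; rewrite mul0mx.
rewrite (bigD1_seq m) ?uniq_eigenvals //= eigenproj_id //.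
by rewrite big1 ?addr0 // => l neq_lm; rewrite (eigenproj_0 neq_lm).
Qed.

Lemma vec_eigen_decomp (v : 'rV[R]_n) :
  v = \sum_(l <- eigenvals A) v *m eigenproj A l.
Proof. by rewrite -mulmx_sumr sum_eigenproj mulmx1. Qed.

Lemma dotv_eigen_decomp (v w : 'rV[R]_n) :
  dotv v w =
  \sum_(l <- eigenvals A) dotv (v *m eigenproj A l) (w *m eigenproj A l).
Proof.
rewrite {1}[v]vec_eigen_decomp dotv_suml; apply: eq_big_seq => l l_ev.
rewrite {1}[w]vec_eigen_decomp dotvC dotv_suml.
rewrite (bigD1_seq l) ?uniq_eigenvals //= big1 ?addr0 1?dotvC // => m neq_ml.
by apply: (eigenvector_dotv0 neq_ml); exact: eigenproj_sub.
Qed.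

End SpectralDecomposition.

Section FunctionalCalculus.
Variables (R : rcfType) (n : nat) (A : 'M[R]_n.+1).
Hypothesis A_sym : A^T = A.
Implicit Types (p q : {poly R}) (v : 'rV[R]_n.+1).

Lemma horner_mxE p : horner_mx A p = \sum_(i < size p) p`_i *: A ^+ i.
Proof.
rewrite -{1}[p]coefK poly_def linear_sum; apply: eq_bigr => i _.
by rewrite linearZ /= rmorphXn /= horner_mx_X.
Qed.

Lemma eigenspace_horner (l : R) v p :
  (v <= eigenspace A l)%MS -> v *m horner_mx A p = p.[l] *: v.
Proof.
move=> /eigenspaceP vA; elim/poly_ind: p => [|p c IHp].
  by rewrite rmorph0 mulmx0 horner0 scale0r.
rewrite rmorphD rmorphM /= horner_mx_X horner_mx_C mulmxDr mulmxA IHp.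
by rewrite -scalemxAl vA mul_mx_scalar scalerA -scalerDl !hornerE.
Qed.

Lemma horner_eigenproj (l : R) v p : l \in eigenvals A ->
  v *m horner_mx A p *m eigenproj A l = p.[l] *: (v *m eigenproj A l).
Proof.
move=> l_ev; rewrite {1}(vec_eigen_decomp A_sym v) !mulmx_suml.
rewrite (bigD1_seq l) ?uniq_eigenvals //= big1 ?addr0 => [|m neq_ml].
  rewrite (eigenspace_horner _ (eigenproj_sub _ _ _)) -scalemxAl.
  by rewrite eigenproj_id ?eigenproj_sub.
rewrite (eigenspace_horner _ (eigenproj_sub _ _ _)) -scalemxAl.
by rewrite (@eigenproj_0 _ _ _ A_sym l m) ?scaler0 ?eigenproj_sub // eq_sym.
Qed.

End FunctionalCalculus.

(** * Local eigenvalues and walks *)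

Section LocalMultiplicities.
Variables (R : rcfType) (n : nat) (A : 'M[R]_n.+1) (nu : 'rV[R]_n.+1).
Hypothesis A_sym : A^T = A.
Hypothesis nu_gt0 : forall i, 0 < nu 0 i.
Implicit Types (S : {set 'I_n.+1}) (p q : {poly R}) (l : R).

Lemma rhoE S i : rho nu S 0 i = if i \in S then nu 0 i else 0.
Proof.
rewrite summxE; case: ifPn => [iS|iNS].
  rewrite (bigD1 i) //= !mxE !eqxx mulr1 big1 ?addr0 // => j /andP[_ neq_ji].
  by rewrite !mxE eqxx eq_sym (negPf neq_ji) mulr0.
rewrite big1 // => j jS; rewrite !mxE eqxx; case: eqP => [ij|_].
  by rewrite ij jS in iNS.
by rewrite mulr0.
Qed.

Lemma rho_neq0 S : S != set0 -> rho nu S != 0.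
Proof.
case/set0Pn => i iS; apply/eqP => /rowP/(_ i) /eqP.
by rewrite rhoE iS mxE gt_eqF.
Qed.

Lemma rho0 : rho nu set0 = 0.
Proof. by rewrite /rho big_set0. Qed.

Lemma local_multE S l :
  local_mult A nu S l =
  (normv (rho nu S)) ^- 2 *
    dotv (rho nu S *m eigenproj A l) (rho nu S *m eigenproj A l).
Proof.
rewrite /local_mult /unit_rho normv_sqr -scalemxAl dotvZl dotvZr mulrA.
by rewrite -invfM -expr2.
Qed.

Lemma normv_rho_neq0 S : S != set0 -> (normv (rho nu S)) ^- 2 != 0.
Proof. by move=> S_neq0; rewrite invr_eq0 normv_sqr dotv_eq0 rho_neq0. Qed.

Lemma local_mult_eq0 S l : S != set0 ->
  (local_mult A nu S l == 0) = (rho nu S *m eigenproj A l == 0).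
Proof.
move=> S_neq0; rewrite local_multE mulf_eq0 (negPf (normv_rho_neq0 S_neq0)).
by rewrite dotv_eq0.
Qed.

Lemma mem_local_ev S l : S != set0 ->
  (l \in local_ev A nu S) =
  (l \in eigenvals A) && (rho nu S *m eigenproj A l != 0).
Proof.
by move=> S_neq0; rewrite mem_filter local_mult_eq0 // andbC.
Qed.

Lemma uniq_local_ev S : uniq (local_ev A nu S).
Proof. by rewrite filter_uniq // uniq_eigenvals. Qed.

(** The components of [p(A) (rho nu S)] are [p(l)] times those of [rho nu S], and
    the latter are nonzero exactly at the local eigenvalues. *)
Lemma rho_horner_eq0 S p : S != set0 ->
  (rho nu S *m horner_mx A p == 0) = all (root p) (local_ev A nu S).
Proof.
move=> S_neq0; apply/eqP/allP => [pS0 l|p_root].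
  rewrite mem_local_ev // => /andP[l_ev].
  have := horner_eigenproj A_sym (rho nu S) p l_ev; rewrite pS0 mul0mx => /esym.
  by move/eqP; rewrite scaler_eq0 => /orP[//|/eqP->]; rewrite eqxx.
rewrite (vec_eigen_decomp A_sym (_ *m _)) big1_seq // => l /= l_ev.
rewrite horner_eigenproj //.
have [->|Sl] := eqVneq (rho nu S *m eigenproj A l) 0; first by rewrite scaler0.
have /rootP-> : root p l by apply: p_root; rewrite mem_local_ev ?l_ev.
by rewrite scale0r.
Qed.

(** Parseval for the eigenvector components; the eigenvalues left out of
    [local_ev] contribute 0. *)
Lemma local_scalarE S p q :
  local_scalar A nu S p q =
  (normv (rho nu S)) ^- 2 *
    dotv (rho nu S *m horner_mx A p) (rho nu S *m horner_mx A q).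
Proof.
rewrite (dotv_eigen_decomp A_sym) mulr_sumr /local_scalar big_filter.
rewrite big_mkcond; apply: eq_big_seq => l l_ev; rewrite !horner_eigenproj //.
rewrite dotvZl dotvZr; case: eqP => [Sl0|_] /=; last by rewrite local_multE; ring.
by rewrite mulrCA [X in _ * X]mulrCA -local_multE Sl0 !mulr0.
Qed.

Lemma size_local_ev_lt S p : S != set0 -> p != 0 ->
  rho nu S *m horner_mx A p = 0 -> (size (local_ev A nu S) < size p)%N.
Proof.
move=> S_neq0 p_neq0 /eqP; rewrite rho_horner_eq0 // => p_root.
exact: max_poly_roots (uniq_local_ev S).
Qed.

(** With at most [s] local eigenvalues, the product of their linear factors
    could be padded to a monic polynomial [p] of degree [s] with
    [p(A) (rho nu S) = 0]; but by hypothesis only the leading term of [p]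
    contributes to coordinate [i], and it is nonzero.  For an adjacency matrix
    the hypotheses say that [i] is at distance [s] from [S]. *)
Lemma size_local_ev_gt S i s : S != set0 ->
  (rho nu S *m A ^+ s) 0 i != 0 ->
  (forall t, (t < s)%N -> (rho nu S *m A ^+ t) 0 i = 0) ->
  (s < size (local_ev A nu S))%N.
Proof.
move=> S_neq0 ws_neq0 wt0; rewrite ltnNge; apply/negP => le_ev_s.
pose p := \prod_(l <- local_ev A nu S) ('X - l%:P)
          * 'X^(s - size (local_ev A nu S)).
have p_monic : p \is monic by rewrite monicMl ?monicXn ?monic_prod_XsubC.
have sz_p : size p = s.+1.
  rewrite size_Mmonic ?monicXn ?monic_neq0 ?monic_prod_XsubC //.
  by rewrite size_prod_XsubC size_polyXn addnS /= addSn subnKC.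
have : rho nu S *m horner_mx A p == 0.
  rewrite rho_horner_eq0 //; apply/allP => l l_ev.
  by rewrite rootM root_prod_XsubC l_ev.
move=> /eqP/rowP/(_ i).
rewrite horner_mxE mulmx_sumr summxE sz_p big_ord_recr /=.
rewrite big1 ?add0r => [|t _]; last by rewrite -scalemxAr mxE wt0 ?mulr0.
have := monicP p_monic; rewrite lead_coefE sz_p /= => ->.
by rewrite scale1r [RHS]mxE => /eqP; rewrite (negPf ws_neq0).
Qed.

End LocalMultiplicities.

(** * Distance to a set of vertices *)

Lemma bigminn_le (I : eqType) (r : seq I) (P : pred I) (F : I -> nat) m j :
  j \in r -> P j -> (\big[minn/m]_(i <- r | P i) F i <= F j)%N.
Proof.
elim: r => // i r IHr; rewrite inE big_cons => /orP[/eqP<- ->|jr Pj].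
  exact: geq_minl.
by case: ifP => _; rewrite ?(leq_trans (geq_minr _ _)) ?IHr.
Qed.

Lemma bigminn_attained (I : eqType) (r : seq I) (P : pred I) (F : I -> nat) m :
  \big[minn/m]_(i <- r | P i) F i = m \/
  exists2 j, P j & \big[minn/m]_(i <- r | P i) F i = F j.
Proof.
apply: (big_rec (fun x => x = m \/ exists2 j, P j & x = F j)); first by left.
move=> j x Pj IHx; rewrite /minn; case: ifP => // _; right; by exists j.
Qed.

Section Levels.
Variables (n : nat) (e : rel 'I_n).
Hypothesis e_conn : forall i j : 'I_n, connect e i j.
Implicit Types (i j : 'I_n) (C : {set 'I_n}).

Lemma gdist_le_walk i w : path e i w -> (gdist e i (last i w) <= size w)%N.
Proof.
move=> w_path; rewrite leqNgt; apply/negP => lt_w.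
have lt_wn : (size w < n)%N.
  by rewrite (leq_trans lt_w) // (leq_trans (find_size _ _)) ?size_iota.
have := before_find 0 lt_w; rewrite nth_iota // add0n => /negbT /existsP[].
by exists (in_tuple w); rewrite w_path eqxx.
Qed.

(** Removing the loops of a walk leaves fewer than [n] steps, so the search in
    [gdist] succeeds and the junk value [n] is never reached. *)
Lemma gdist_walk i j :
  exists w, [/\ path e i w, last i w = j, size w = gdist e i j & (size w < n)%N].
Proof.
set a := fun k : nat => [exists w : k.-tuple 'I_n, path e i w && (last i w == j)].
have a_has : has a (iota 0 n).
  have [w w_path w_last] := connectP (e_conn i j).
  case/shortenP: w_path w_last => w' w'_path w'_uniq _ w'_last.
  apply/hasP; exists (size w').
    rewrite mem_iota /= add0n; have := max_card (mem (i :: w')).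
    by rewrite (card_uniqP w'_uniq) card_ord.
  by apply/existsP; exists (in_tuple w'); rewrite w'_path w'_last eqxx.
have lt_n : (gdist e i j < n)%N by have := a_has; rewrite has_find size_iota.
have := nth_find 0 a_has; rewrite nth_iota ?add0n // => /existsP[w].
by case/andP=> w_path /eqP w_last; exists w; rewrite w_path size_tuple.
Qed.

Lemma gdist_set_le C i w : path e i w -> last i w \in C ->
  (gdist_set e C i <= size w)%N.
Proof.
move=> w_path w_last; apply: leq_trans (_ : gdist e i (last i w) <= _)%N.
  exact: bigminn_le (mem_index_enum _) w_last.
exact: gdist_le_walk.
Qed.

(** The default [n] of the minimum is not attained, because real distances are
    smaller. *)
Lemma gdist_set_walk C i : C != set0 ->
  exists w, [/\ path e i w, last i w \in C & size w = gdist_set e C i].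
Proof.
case/set0Pn => j0 j0C.
have [dist_n|[j jC ->]] : gdist_set e C i = n \/
    exists2 j, j \in C & gdist_set e C i = gdist e i j.
- exact: bigminn_attained.
  have [w [w_path w_last sz_w lt_wn]] := gdist_walk i j0.
  have := @gdist_set_le C _ _ w_path; rewrite w_last => /(_ j0C).
  by rewrite dist_n leqNgt lt_wn.
have [w [w_path w_last sz_w _]] := gdist_walk i j.
by exists w; rewrite w_last.
Qed.

Variable C : {set 'I_n}.
Hypothesis C_neq0 : C != set0.
Local Notation lev := (gdist_set e C).

Lemma lev_eq0 i : (lev i == 0)%N = (i \in C).
Proof.
apply/idP/idP => [/eqP lev0|iC]; last first.
  by rewrite -leqn0 (@gdist_set_le C i [::]).
have [w [_]] := gdist_set_walk i C_neq0; rewrite lev0.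
by move=> + /size0nil w0; rewrite w0.
Qed.

Lemma lev_edge i j : e i j -> (lev i <= (lev j).+1)%N.
Proof.
move=> eij; have [w [w_path w_last <-]] := gdist_set_walk j C_neq0.
by apply: (@gdist_set_le C i (j :: w)) => //=; rewrite eij.
Qed.

Lemma lev_pred i k : lev i = k.+1 -> exists2 j, e i j & lev j = k.
Proof.
have [w [+ + +]] := gdist_set_walk i C_neq0.
move=> + + + lev_i; rewrite lev_i.
case: w => [|j w] //= /andP[eij w_path] w_last [sz_w].
exists j => //; have := lev_edge eij; rewrite lev_i => le_k.
by apply/eqP; rewrite eqn_leq -{1}sz_w gdist_set_le.
Qed.

Lemma lev_le_ecc i : (lev i <= eccentricity e C)%N.
Proof. exact: (@bigop.leq_bigmax _ lev i). Qed.

Lemma ecc_attained : exists i, lev i = eccentricity e C.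
Proof.
rewrite /eccentricity; have [|i ->] := @bigop.eq_bigmax _ lev; last by exists i.
by case/set0Pn: C_neq0 => i _; apply/card_gt0P; exists i.
Qed.

(** A shortest walk from a farthest vertex to [C] meets every layer. *)
Lemma lev_nonempty k : (k <= eccentricity e C)%N -> exists i, lev i = k.
Proof.
have [i0 lev_i0] := ecc_attained.
have lev_down m : (m <= eccentricity e C)%N ->
  exists i, lev i = (eccentricity e C - m)%N.
  elim: m => [|m IHm] lt_m; first by exists i0; rewrite subn0.
  have [i lev_i] := IHm (ltnW lt_m).
  have [|j _ lev_j] := @lev_pred i (eccentricity e C - m.+1); last by exists j.
  by rewrite lev_i -subSn // subSS.
move=> le_k; have [|i lev_i] := lev_down (eccentricity e C - k)%N; first lia.
by exists i; rewrite lev_i subKn.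
Qed.

Lemma subconstituent_neq0 k : (k <= eccentricity e C)%N ->
  subconstituent e C k != set0.
Proof.
by move=> /lev_nonempty[i lev_i]; apply/set0Pn; exists i; rewrite inE lev_i.
Qed.

Lemma subconstituent0 : subconstituent e C 0 = C.
Proof. by apply/setP => i; rewrite inE lev_eq0. Qed.

Lemma subconstituent_ecc_succ : subconstituent e C (eccentricity e C).+1 = set0.
Proof.
apply/setP => i; rewrite !inE; apply/negbTE.
by rewrite neq_ltn ltnS lev_le_ecc.
Qed.

End Levels.

(** * Completely pseudo-regular codes *)

Lemma size_cancel_lead (F : fieldType) (p q : {poly F}) k :
  (size p <= k.+1)%N -> size q = k.+1 ->
  (size (p - p`_k / lead_coef q *: q)%R <= k)%N.
Proof.
move=> sz_p sz_q; have q_neq0 : q`_k != 0.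
  have : lead_coef q != 0 by rewrite lead_coef_eq0 -size_poly_gt0 sz_q.
  by rewrite lead_coefE sz_q.
rewrite lead_coefE sz_q /=; apply/leq_sizeP => j.
rewrite coefB coefZ leq_eqVlt => /orP[/eqP<-|lt_kj].
  by rewrite mulfVK ?subrr.
rewrite [p`_j]nth_default ?(leq_trans sz_p) // [q`_j]nth_default ?sz_q //.
by rewrite mulr0 subrr.
Qed.

Section Code.
Variables (R : rcfType) (n : nat) (e : rel 'I_n.+1) (nu : 'rV[R]_n.+1).
Variable C : {set 'I_n.+1}.
Hypothesis e_sym : symmetric e.
Hypothesis e_conn : forall i j, connect e i j.
Hypothesis nu_gt0 : forall i, 0 < nu 0 i.
Hypothesis C_neq0 : C != set0.
Implicit Types (S : {set 'I_n.+1}) (p : nat -> {poly R}) (q r : {poly R}).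
Local Notation A := (adjacency R e).
Local Notation lev := (gdist_set e C).
Local Notation ecc := (eccentricity e C).
Local Notation layer := (subconstituent e C).

Lemma adjacency_sym : A^T = A.
Proof. by apply/matrixP => i j; rewrite !mxE e_sym. Qed.

Lemma mul_adjacencyE (v : 'rV[R]_n.+1) i :
  (v *m A) 0 i = \sum_(j | e i j) v 0 j.
Proof.
rewrite mxE [RHS]big_mkcond; apply: eq_bigr => j _; rewrite mxE e_sym.
by case: e; rewrite ?mulr1 ?mulr0.
Qed.

Lemma mul_adjacency_expS (v : 'rV[R]_n.+1) s i :
  (v *m A ^+ s.+1) 0 i = \sum_(j | e i j) (v *m A ^+ s) 0 j.
Proof. by rewrite exprSr mulmxA mul_adjacencyE. Qed.

Lemma walk_ge0 S s i : 0 <= (rho nu S *m A ^+ s) 0 i.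
Proof.
elim: s i => [|s IHs] i; last by rewrite mul_adjacency_expS sumr_ge0.
by rewrite mulmx1 rhoE; case: ifP => // _; rewrite ltW.
Qed.

Lemma walk_step_gt0 S s i j : e i j ->
  0 < (rho nu S *m A ^+ s) 0 j -> 0 < (rho nu S *m A ^+ s.+1) 0 i.
Proof.
move=> eij wj; rewrite mul_adjacency_expS (bigD1 j) //=.
by rewrite ltr_wpDr // sumr_ge0 // => k _; exact: walk_ge0.
Qed.

(** One step of a walk changes the distance to [C] by at most 1. *)
Lemma walk_far0 k s i : (k + s < lev i)%N || (lev i + s < k)%N ->
  (rho nu (layer k) *m A ^+ s) 0 i = 0.
Proof.
elim: s i => [|s IHs] i far_i.
  by rewrite mulmx1 rhoE inE; case: eqP => // lev_i; lia.
rewrite mul_adjacency_expS big1 // => j eij; apply: IHs.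
have := lev_edge e_conn C_neq0 eij; rewrite e_sym in eij.
by have := lev_edge e_conn C_neq0 eij; lia.
Qed.

Lemma walk_up_gt0 k s i : lev i = (k + s)%N ->
  0 < (rho nu (layer k) *m A ^+ s) 0 i.
Proof.
elim: s i => [|s IHs] i lev_i.
  by rewrite mulmx1 rhoE inE lev_i addn0 eqxx.
rewrite addnS in lev_i; have [j eij lev_j] := lev_pred e_conn C_neq0 lev_i.
exact: walk_step_gt0 eij (IHs j lev_j).
Qed.

Lemma walk_down_gt0 k s : (s <= k <= ecc)%N ->
  exists2 i, lev i = (k - s)%N & 0 < (rho nu (layer k) *m A ^+ s) 0 i.
Proof.
case/andP=> + le_k; elim: s => [|s IHs] lt_s.
  have [i lev_i] := lev_nonempty e_conn C_neq0 le_k.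
  by exists i; rewrite ?subn0 // mulmx1 rhoE inE lev_i eqxx.
have [i lev_i w_i] := IHs (ltnW lt_s).
have [|j eij lev_j] := @lev_pred _ e e_conn C C_neq0 i (k - s.+1); first by lia.
by exists j => //; apply: walk_step_gt0 w_i; rewrite e_sym.
Qed.

(** The bound comes from two walks that start in layer [k] and are shortest: [k]
    steps down to [C], and [ecc - k] steps up to the last layer. *)
Lemma size_local_ev_subconstituent k : (k <= ecc)%N ->
  (maxn k (ecc - k) < size (local_ev A nu (layer k)))%N.
Proof.
move=> le_k; have Ck_neq0 := subconstituent_neq0 e_conn C_neq0 le_k.
rewrite gtn_max; apply/andP; split.
  have [|i lev_i w_i] := @walk_down_gt0 k k; first by rewrite leqnn.
  apply: (size_local_ev_gt adjacency_sym nu_gt0 (i := i)) => //.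
    by rewrite gt_eqF.
  by move=> t lt_t; apply: walk_far0; lia.
have [i lev_i] := lev_nonempty e_conn C_neq0 (leqnn ecc).
apply: (size_local_ev_gt adjacency_sym nu_gt0 (i := i)) => //.
  by rewrite gt_eqF // walk_up_gt0 // subnKC.
by move=> t lt_t; apply: walk_far0; lia.
Qed.

Lemma rho_mul_adjacency k i :
  (rho nu (layer k) *m A) 0 i = nu 0 i * nbr_weight e nu C i k.
Proof.
rewrite mul_adjacencyE mulVKf ?gt_eqF // [RHS]big_mkcondr.
by apply: eq_bigr => j _; rewrite rhoE.
Qed.

Hypothesis C_cpr : completely_pseudo_regular e nu C.

(** The layers form an equitable partition with respect to the weights [nu]: the
    intersection numbers are the coefficients.  For [k < ecc], [c] is positive since
    each vertex of layer [k + 1] has a neighbour in layer [k]; at the last layer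
    [rho nu (layer k.+1)] is 0 and any nonzero [c] will do, which lets the
    recurrence produce an annihilating polynomial at [k = ecc]. *)
Lemma rho_recurrence k : (k <= ecc)%N -> exists a b c : R, c != 0 /\
  rho nu (layer k) *m A = c *: rho nu (layer k.+1) + a *: rho nu (layer k)
    + b *: (if k is k'.+1 then rho nu (layer k') else 0).
Proof.
move=> le_k.
have nbr0 i : (k.+1 < lev i)%N || ((lev i).+1 < k)%N -> nbr_weight e nu C i k = 0.
  move=> far_i; rewrite /nbr_weight big1 ?mulr0 // => j /andP[eij].
  rewrite inE => /eqP lev_j; have := lev_edge e_conn C_neq0 eij.
  by rewrite e_sym in eij; have := lev_edge e_conn C_neq0 eij; lia.
have [c [c_neq0 cE]] : exists c : R, c != 0 /\
    forall i, lev i = k.+1 -> nbr_weight e nu C i k = c.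
  have [lt_k|ge_k] := ltnP k ecc; last first.
    exists 1; split=> [|i lev_i]; first exact: oner_neq0.
    by have := lev_le_ecc e C i; lia.
  have [i0 lev_i0] := lev_nonempty e_conn C_neq0 lt_k.
  exists (nbr_weight e nu C i0 k); split=> [|i lev_i]; last first.
    have := @C_cpr k.+1 lt_k i i0; rewrite !inE lev_i lev_i0 eqxx => -[//|//|].
    by rewrite /code_c lev_i lev_i0.
  have := @walk_up_gt0 k 1 i0; rewrite addn1 expr1 rho_mul_adjacency => /(_ lev_i0).
  by apply: contraTneq => ->; rewrite mulr0 ltxx.
have [a aE] : exists a : R, forall i, lev i = k -> nbr_weight e nu C i k = a.
  have [i0 lev_i0] := lev_nonempty e_conn C_neq0 le_k.
  exists (nbr_weight e nu C i0 k) => i lev_i.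
  have := @C_cpr k le_k i i0; rewrite !inE lev_i lev_i0 eqxx => -[//|//|_ + _].
  by rewrite /code_a lev_i lev_i0.
have [b bE] : exists b : R, forall i, (lev i).+1 = k -> nbr_weight e nu C i k = b.
  case: k le_k {nbr0 c cE c_neq0 a aE} => [|k] lt_k; first by exists 0.
  have [i0 lev_i0] := lev_nonempty e_conn C_neq0 (ltnW lt_k).
  exists (nbr_weight e nu C i0 k.+1) => i [lev_i].
  have := @C_cpr k (ltnW lt_k) i i0.
  rewrite !inE lev_i lev_i0 eqxx => -[//|//|_ _].
  by rewrite /code_b lev_i lev_i0 ltn_eqF.
exists a, b, c; split=> //; apply/rowP => i; rewrite rho_mul_adjacency !mxE.
have -> : (if k is k'.+1 then rho nu (layer k') else 0) 0 i =
          if ((lev i).+1 == k)%N then nu 0 i else 0.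
  by case: k {le_k nbr0 cE aE bE} => [|k]; rewrite ?mxE // rhoE inE.
rewrite !rhoE !inE.
have [eq1|neq1] := eqVneq (lev i) k.+1.
  rewrite cE // eq1 !gtn_eqF ?ltnS ?leqnSn //; ring.
have [eq2|neq2] := eqVneq (lev i) k.
  rewrite aE // eq2 gtn_eqF //; ring.
have [eq3|neq3] := eqVneq (lev i).+1 k; first by rewrite bE //; ring.
by rewrite nbr0; [ring | lia].
Qed.

(** Solving the recurrence for the next layer raises the degree by exactly 1 as
    [c] is nonzero.  The range includes the empty layer [ecc + 1]. *)
Lemma rho_subconstituent_horner k : (k <= ecc.+1)%N ->
  exists q : {poly R}, size q = k.+1 /\ rho nu C *m horner_mx A q = rho nu (layer k).
Proof.
elim/ltn_ind: k => -[|k] IHk le_k.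
  exists 1; rewrite size_poly1 rmorph1 mulmx1.
  by rewrite (subconstituent0 e_conn C_neq0).
have [q [sz_q qE]] := IHk k (leqnn _) (ltnW le_k).
have [a [b [c [c_neq0 recE]]]] := rho_recurrence le_k.
have [q' [sz_q' q'E]] : exists q' : {poly R}, (size q' <= k)%N /\
    rho nu C *m horner_mx A q' = if k is k'.+1 then rho nu (layer k') else 0.
  case: k IHk le_k {q sz_q qE recE} => [|k] IHk le_k.
    by exists 0; rewrite size_poly0 rmorph0 mulmx0.
  by have [||q' [<- q'E]] := IHk k; [lia | lia | exists q'].
exists (c^-1 *: (q * 'X - (a *: q + b *: q'))); split.
  have q_neq0 : q != 0 by rewrite -size_poly_gt0 sz_q.
  rewrite size_scale ?invr_eq0 // size_polyDl size_mulX ?sz_q // size_polyN.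
  rewrite ltnS (leq_trans (size_polyD _ _)) // geq_max.
  by rewrite !(leq_trans (size_scale_leq _ _)) ?sz_q // (leq_trans sz_q').
rewrite horner_mxZ rmorphB rmorphM rmorphD /= !horner_mxZ horner_mx_X -scalemxAr.
rewrite mulmxBr mulmxDr -!scalemxAr mulmxA qE q'E recE -[X in X - _]addrA addrK.
by rewrite scalerA mulVf // scale1r.
Qed.

(** At the empty layer [ecc + 1] the polynomial of degree [ecc + 1] kills
    [rho nu C], so [C] has at most [ecc + 1] local eigenvalues; the converse bound
    is the case [k = 0] of the estimate for layers. *)
Lemma dual_degree_ecc : dual_degree A nu C = ecc.
Proof.
have [q [sz_q qE]] := rho_subconstituent_horner (leqnn _).
rewrite (subconstituent_ecc_succ e C) rho0 in qE.
have q_neq0 : q != 0 by rewrite -size_poly_gt0 sz_q.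
have := size_local_ev_lt adjacency_sym nu_gt0 C_neq0 q_neq0 qE.
have := size_local_ev_subconstituent (leq0n ecc).
rewrite (subconstituent0 e_conn C_neq0) sz_q subn0 max0n /dual_degree.
lia.
Qed.

Lemma dual_degree_subconstituent k : (k <= ecc)%N ->
  (maxn k (dual_degree A nu C - k) <= dual_degree A nu (layer k))%N.
Proof.
move=> le_k; have := size_local_ev_subconstituent le_k.
by rewrite dual_degree_ecc /dual_degree; lia.
Qed.

(** The [p m] with [m < k] have every degree below [k], so they span the
    polynomials of size at most [k]. *)
Lemma predistance_orthogonal S p k r : is_predistance_family A nu S p ->
  (k <= dual_degree A nu S)%N -> (size r <= k)%N ->
  local_scalar A nu S (p k) r = 0.
Proof.
move=> [sz_p p_orth] le_k.
suff orth m : (m <= k)%N -> forall r' : {poly R}, (size r' <= m)%N ->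
  local_scalar A nu S (p k) r' = 0 by exact: orth.
elim: m => [|m IHm] le_m r' sz_r'.
  rewrite leqn0 size_poly_eq0 in sz_r'; rewrite (eqP sz_r').
  by rewrite /local_scalar big1 // => l _; rewrite horner0 mulr0.
have le_md : (m <= dual_degree A nu S)%N by rewrite (leq_trans (ltnW le_m)).
have sz_pm := sz_p m le_md.
have sz_r := size_cancel_lead sz_r' sz_pm; set c := _ / _ in sz_r.
have := IHm (ltnW le_m) _ sz_r.
have -> : local_scalar A nu S (p k) (r' - c *: p m) =
  local_scalar A nu S (p k) r' - c * local_scalar A nu S (p k) (p m).
  rewrite /local_scalar mulr_sumr -sumrB; apply: eq_bigr => l _.
  by rewrite hornerD hornerN hornerZ; ring.
by rewrite p_orth // gtn_eqF // mul0r mulr0 subr0.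
Qed.

(** A polynomial of degree less than [k] does not reach layer [k] from [C]. *)
Lemma rho_horner_level0 r k i : (size r <= k)%N -> lev i = k ->
  (rho nu C *m horner_mx A r) 0 i = 0.
Proof.
move=> sz_r lev_i; rewrite horner_mxE mulmx_sumr summxE big1 // => t _.
rewrite -scalemxAr mxE -(subconstituent0 e_conn C_neq0) walk_far0 ?mulr0 //.
by rewrite lev_i add0n (leq_trans (ltn_ord t)).
Qed.

(** Cancelling leading terms leaves [r = q - c p_k] of degree less than [k].  It is
    orthogonal to [p_k], and also to [q], because [q(A) (rho nu C)] is supported in
    layer [k], which [r(A) (rho nu C)] does not reach.  Hence [r] has norm 0 and
    vanishes on the local eigenvalues of [C]. *)
Lemma predistance_proportional p k q : is_predistance_family A nu C p ->
  (k <= ecc)%N -> size q = k.+1 -> rho nu C *m horner_mx A q = rho nu (layer k) ->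
  {in local_ev A nu C, forall l, root (p k) l = root q l}.
Proof.
move=> p_dist le_k sz_q qE; have le_kd : (k <= dual_degree A nu C)%N.
  by rewrite dual_degree_ecc.
have sz_p := proj1 p_dist k le_kd.
pose c := lead_coef q / lead_coef (p k); pose r := q - c *: p k.
have lp_neq0 : lead_coef (p k) != 0 by rewrite lead_coef_eq0 -size_poly_gt0 sz_p.
have lq_neq0 : lead_coef q != 0 by rewrite lead_coef_eq0 -size_poly_gt0 sz_q.
have sz_r : (size r <= k)%N.
  have := @size_cancel_lead _ q (p k) k; rewrite sz_q => /(_ (leqnn _) sz_p).
  by rewrite /r /c [lead_coef q]lead_coefE sz_q.
have qr0 : local_scalar A nu C q r = 0.
  rewrite (local_scalarE _ adjacency_sym) qE dotvE big1 ?mulr0 // => i _.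
  rewrite rhoE inE; case: eqP => [lev_i|_]; last by rewrite mul0r.
  by rewrite (rho_horner_level0 sz_r lev_i) mulr0.
have : local_scalar A nu C r r = 0.
  have -> : local_scalar A nu C r r =
    local_scalar A nu C q r - c * local_scalar A nu C (p k) r.
    rewrite /local_scalar mulr_sumr -sumrB; apply: eq_bigr => l _.
    by rewrite {2}/r hornerD hornerN hornerZ; ring.
  by rewrite qr0 (predistance_orthogonal p_dist) // mulr0 subr0.
move/eqP; rewrite (local_scalarE _ adjacency_sym) mulf_eq0.
rewrite (negPf (normv_rho_neq0 nu_gt0 C_neq0)) dotv_eq0.
rewrite (rho_horner_eq0 adjacency_sym nu_gt0) // => /allP r_root l l_ev.
have /rootP := r_root l l_ev; rewrite !hornerE => /eqP; rewrite subr_eq0.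
by rewrite !rootE => /eqP->;
  rewrite !mulf_eq0 invr_eq0 (negPf lp_neq0) (negPf lq_neq0).
Qed.

(** The component of [rho nu S'] at [l] is [q(l)] times that of [rho nu S]. *)
Lemma local_ev_horner S S' q : S != set0 -> S' != set0 ->
  rho nu S *m horner_mx A q = rho nu S' ->
  local_ev A nu S' = [seq l <- local_ev A nu S | ~~ root q l].
Proof.
move=> S_neq0 S'_neq0 qE; rewrite /local_ev -filter_predI.
apply: eq_in_filter => l l_ev /=.
rewrite !(local_mult_eq0 _ nu_gt0) // -qE horner_eigenproj ?adjacency_sym //.
by rewrite scaler_eq0 negb_or rootE.
Qed.

Lemma predistance_roots p k : is_predistance_family A nu C p ->
  (k <= dual_degree A nu C)%N ->
  (size [seq mu <- local_ev A nu C | root (p k) mu]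
     <= minn k (dual_degree A nu C - k))%N.
Proof.
move=> p_dist; rewrite dual_degree_ecc => le_k.
have [q [sz_q qE]] := rho_subconstituent_horner (leqW le_k).
have Ck_neq0 := subconstituent_neq0 e_conn C_neq0 le_k.
rewrite (eq_in_filter (predistance_proportional p_dist le_k sz_q qE)).
have := size_local_ev_subconstituent le_k.
rewrite (local_ev_horner C_neq0 Ck_neq0 qE) !size_filter.
rewrite -[X in (_ < X)%N]/(count (predC (root q)) (local_ev A nu C)).
have := count_predC (root q) (local_ev A nu C); have := dual_degree_ecc.
rewrite /dual_degree; move: (count _ _) (count _ _) (size _) => x y z.
lia.
Qed.

End Code.

Theorem mainTheorem4 (R : realType) (n : nat) (e : rel 'I_n)
  (e_sym : symmetric e) (e_irr : irreflexive e)
  (e_conn : forall i j : 'I_n, connect e i j)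
  (nu : 'rV[R]_n) (nu_perron : is_perron_vector (adjacency R e) nu)
  (C : {set 'I_n}) (C_neq0 : C != set0)
  (C_cpr : completely_pseudo_regular e nu C) :
  let A := adjacency R e in
  let d := dual_degree A nu C in
  (forall k : nat, (k <= eccentricity e C)%N ->
     (maxn k (d - k) <= dual_degree A nu (subconstituent e C k))%N) /\
  (forall p : nat -> {poly R}, is_predistance_family A nu C p ->
   forall k : nat, (k <= d)%N ->
     (size [seq mu <- local_ev A nu C | root (p k) mu] <= minn k (d - k))%N).
Proof.
case: n e e_sym e_irr e_conn nu nu_perron C C_neq0 C_cpr => [|n] e e_sym _
    e_conn nu [_ nu_gt0 _ _] C C_neq0 C_cpr.
  by case/set0Pn: C_neq0 => -[].
split=> [k le_k|p p_dist k le_k].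
  exact: dual_degree_subconstituent.
exact: predistance_roots.
Qed.
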